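(* Consider an NTU LP game given by $A,\{b^i\}_{i\in N},\{v^i\}_{i\in N}$, with sets $Z(N)$, $U'(S)$, core $C(N)$ and extended core $C'(N)$. Let $P'\subseteq\mathbb{R}^J\times\mathbb{R}^N$ be a polyhedron satisfying $\mathrm{conv}(C'(N))\subseteq P'\subseteq Z(N)$ and let $(x^*,u^* )\in P'$ be an extreme point of $P'$. If $u^*\notin C(N)$, then there exists an intersection cut (for $P'$, the closed convex set $U'(S)$ for some coalition $\emptyset\neq S\subseteq N$, and the point $(x^*,u^* )$) that strengthens $P'$ into a polyhedron $\hat P'$ (the intersection of $P'$ with the half-space defined by the cut) satisfying $$\mathrm{conv}(C'(N))\subseteq\hat P'\subsetneq P'\subseteq Z(N).$$
   Context: Let $N$ (players), $K$ (resources), $J$ (public goods) be finite non-empty sets. The data are a production matrix $A\in\mathbb{Q}^{K\times J}$, resource endowments $b^i\in\mathbb{Q}^K$ and valuation vectors $v^i\in\mathbb{Q}^J$ for $i\in N$. For a coalition $\emptyset\neq S\subseteq N$ put $b(S)=\sum_{i\in S}b^i$ and $$X(S)=\{x\in\mathbb{R}^J_{\geq 0}: Ax\leq b(S)\},$$ $$Z(S)=\{(x,u)\in\mathbb{R}^J\times\mathbb{R}^N: x\in X(S),\ u_i\leq (v^i)^Tx\ \ \forall i\in S\},$$ $$U(S)=\mathrm{proj}_u(Z(S))\subseteq\mathbb{R}^N,\qquad U'(S)=\{(x,u)\in\mathbb{R}^J\times\mathbb{R}^N: u\in U(S)\}.$$ The core is $C(N)=U(N)\setminus\bigcup_{\emptyset\neq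 S\subseteq N}\mathrm{int}(U(S))$ (interior in $\mathbb{R}^N$) and the extended core is $C'(N)=Z(N)\setminus\bigcup_{\emptyset\neq S\subseteq N}\mathrm{int}(U'(S))$ (interior in $\mathbb{R}^J\times\mathbb{R}^N$). Intersection cut: let $F=\{f\in\mathbb{R}^d: c_l^Tf\leq d_l,\ l\in L\}$ be a polyhedron ($L$ finite), $O\subseteq\mathbb{R}^d$ a closed convex set, and $f^*\in F\cap\mathrm{int}(O)$ a basic solution, i.e. there is a set $B\subseteq L$ of $d$ constraints with $\{c_l\}_{l\in B}$ linearly independent and $c_l^Tf^*=d_l$ for $l\in B$. The non-basic variables are the slacks $f_l=d_l-c_l^Tf$, $l\in B$; the cone $\{f: f_l\geq 0\ \forall l\in B\}$ contains $F$, has apex $f^*$, and has extreme rays $r^l$, $l\in B$, where $r^l$ is the direction along which the slack $f_l$ increases at unit rate while the slacks of the other members of $B$ stay $0$. Put $\zeta_l=\sup\{\zeta\geq 0: f^*+\zeta r^l\in O\}\in(0,\infty]$. The associated intersection cut is the inequality $\sum_{l\in B}\frac{1}{\zeta_l}f_l\geq 1$, with the convention $1/\infty=0$; it is a valid inequality for $\mathrm{conv}(F\setminus\mathrm{int}(O))$ that is violated by $f^*$. *)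

(* Defs.v *)
From HB Require Import structures.
From mathcomp Require Import all_boot all_order all_algebra.
From mathcomp Require Import all_classical all_reals all_analysis.

Set Implicit Arguments.
Unset Strict Implicit.
Unset Printing Implicit Defensive.

Import Order.TTheory GRing.Theory Num.Theory.
Import numFieldNormedType.Exports.

Local Open Scope classical_set_scope.
Local Open Scope ring_scope.

Section Convexity.
Variables (R : realType) (d : nat).
Implicit Types P A : set 'cV[R]_d.

Definition is_convex A : Prop := @convex_set R 'cV[R]_d A.

Definition convex_hull A : set 'cV[R]_d := smallest is_convex A.

Definition extreme_point P (f : 'cV[R]_d) : Prop :=
  P f /\ forall (g h : 'cV[R]_d) (t : R), P g -> P h -> 0 < t -> t < 1 ->
    f = t *: g + (1 - t) *: h -> g = f /\ h = f.

End Convexity.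

(* The rows of C are the c_l^T and the entries of D are the d_l. *)
Definition polyhedron (R : realType) (m d : nat)
    (C : 'M[R]_(m, d)) (D : 'cV[R]_m) : set 'cV[R]_d :=
  [set f : 'cV[R]_d | forall l, (C *m f) l 0 <= D l 0].

Definition is_polyhedron (R : realType) (d : nat) (P : set 'cV[R]_d) : Prop :=
  exists (m : nat) (C : 'M[R]_(m, d)) (D : 'cV[R]_m), P = polyhedron C D.

Section IntersectionCut.
Variables (R : realType) (m d : nat).
Variables (C : 'M[R]_(m, d)) (D : 'cV[R]_m).
Implicit Types (B : {set 'I_m}) (O H : set 'cV[R]_d) (f : 'cV[R]_d).

Definition slack (l : 'I_m) f : R := D l 0 - (C *m f) l 0.

Definition basic_solution B f : Prop :=
  [/\ #|B| = d,
      row_free (rowsub (fun i : 'I_#|B| => enum_val i) C)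
    & forall l, l \in B -> (C *m f) l 0 = D l 0].

(* The slack of l changes along r at rate - c_l^T r.  For a basis B this
   determines r l for l \in B; the other values of r are irrelevant. *)
Definition basic_rays B (r : 'I_m -> 'cV[R]_d) : Prop :=
  forall l k, l \in B -> k \in B -> - (C *m r l) k 0 = (k == l)%:R.

Definition step_length O f (r : 'cV[R]_d) : \bar R :=
  ereal_sup [set z%:E | z in [set z : R | 0 <= z /\ O (f + z *: r)]].

(* The inverse is the one of \bar R, for which +oo^-1 = 0. *)
Definition cut_halfspace B (r : 'I_m -> 'cV[R]_d) O fstar : set 'cV[R]_d :=
  [set f : 'cV[R]_d | 1 <= \sum_(l in B)
                  fine ((step_length O fstar (r l))^-1)%E * slack l f].

Definition intersection_cut O fstar H : Prop :=
  [/\ closed O, is_convex O, polyhedron C D fstar, interior O fstar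
    & exists B (r : 'I_m -> 'cV[R]_d),
        [/\ basic_solution B fstar, basic_rays B r
          & H = cut_halfspace B r O fstar]].

End IntersectionCut.

(* Players, resources and public goods are indexed by 'I_n, 'I_k and 'I_j. *)
Record lp_game (n k j : nat) := LPGame {
  production : 'M[rat]_(k, j);
  endowment : 'I_n -> 'cV[rat]_k;
  valuation : 'I_n -> 'cV[rat]_j
}.

(* R^J x R^N is 'cV[R]_(j + n): the pair (x, u) is col_mx x u, with projections
   usubmx and dsubmx. *)
Section Game.
Variables (R : realType) (n k j : nat) (G : lp_game n k j).
Implicit Type S : {set 'I_n}.

Definition Xset S : set 'cV[R]_j :=
  [set x : 'cV[R]_j | (forall q, 0 <= x q 0) /\
           (forall p, (map_mx ratr (production G) *m x) p 0 <=
                      ratr ((\sum_(i in S) endowment G i) p 0))].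

Definition Zset S : set 'cV[R]_(j + n) :=
  [set f : 'cV[R]_(j + n) | Xset S (usubmx f) /\
           (forall i, i \in S ->
              (dsubmx f) i 0 <=
              ((map_mx ratr (valuation G i))^T *m usubmx f) 0 0)].

Definition Uset S : set 'cV[R]_n := dsubmx @` Zset S.

Definition U'set S : set 'cV[R]_(j + n) := dsubmx @^-1` Uset S.

Definition coalition S : Prop := S <> finset.set0.

Definition core : set 'cV[R]_n :=
  Uset finset.setT `\` \bigcup_(S in coalition) interior (Uset S).

Definition extended_core : set 'cV[R]_(j + n) :=
  Zset finset.setT `\` \bigcup_(S in coalition) interior (U'set S).

End Game.

Arguments Zset R {n k j} G S.
Arguments Uset R {n k j} G S.
Arguments U'set R {n k j} G S.
Arguments core R {n k j} G.
Arguments extended_core R {n k j} G.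

(* Main.v *)
(* Every point of P' lies in Z(N), so ustar is in U(N) and can only fail to be
   in the core if it is interior to U(S) for some coalition S.  Then (xstar, ustar)
   is interior to U'(S), which is convex, and closed because Fourier-Motzkin
   elimination of x exhibits U(S) as a finite intersection of closed sets.  The
   constraints active at an extreme point have full rank, so (xstar, ustar) is a
   basic solution and spans an intersection cut.  The cut is violated there, and
   it is satisfied by every point of P' outside int U'(S), hence by C'(N). *)
Require Import Defs.
From mathcomp Require Import all_boot all_order all_algebra.
From mathcomp Require Import all_classical all_reals all_analysis.
From mathcomp Require Import ring lra.
Import numFieldNormedType.Exports.
Import Order.TTheory GRing.Theory Num.Theory.
Local Open Scope classical_set_scope.
Local Open Scope ring_scope.

Set Implicit Arguments.
Unset Strict Implicit.
Unset Printing Implicit Defensive.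

(** * Interior points and convex combinations *)

Lemma interior_homothety (R : realType) (V : normedModType R) (A : set V)
    (c : R) (w x : V) :
  c != 0 -> (forall y, A y -> A (c *: y + w)) ->
  interior A x -> interior A (c *: x + w).
Proof.
move=> c0 cA Ax; pose h (y : V) := c^-1 *: (y - w).
pose z : V := c *: x + w; rewrite -/z.
have hz : h z = x by rewrite /h addrK scalerA mulVf// scale1r.
have h_cont : h y @[y --> z] --> h z.
  apply: cvgZ; first exact: cvg_cst.
  by apply: cvgB; [exact: cvg_id | exact: cvg_cst].
have /h_cont Ah : nbhs (h z) A by rewrite hz.
have : \forall y \near z, A (h y) by exact: Ah.
apply: filterS => y /cA.
by rewrite /h scalerA mulfV// scale1r subrK.
Qed.

Lemma interior_ray (R : realType) (V : normedModType R) (A : set V) (x v : V) :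
  interior A x -> exists2 z : R, 0 < z & A (x + z *: v).
Proof.
move=> Ax.
have h_cont : (x + z *: v) @[z --> (0 : R)] --> x + (0 : R) *: v.
  apply: cvgD; first exact: cvg_cst.
  by apply: cvgZ; [exact: cvg_id | exact: cvg_cst].
have /h_cont Ah : nbhs (x + (0 : R) *: v) A by rewrite scale0r addr0.
have /nbhs_ballP[e /= e_gt0 eA] : \forall z \near (0 : R), A (x + z *: v).
  by exact: Ah.
exists (e / 2); first by rewrite divr_gt0.
apply: eA; rewrite /ball/= sub0r normrN gtr0_norm ?divr_gt0//.
by rewrite ltr_pdivrMr// ltr_pMr// ltr1n.
Qed.

Section Convex.
Variables (R : realType) (d : nat).
Implicit Types (A : set 'cV[R]_d) (x y : 'cV[R]_d).

Lemma is_convexP A :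
  is_convex A <->
  (forall x y (t : R), A x -> A y -> 0 < t -> t < 1 ->
     A (t *: x + (1 - t) *: y)).
Proof.
split=> [/convex_setW cA x y t Ax Ay t0 t1 | cA].
  have t01 : Itv.spec (@Itv.num_sem R) (Itv.Real `[0%Z, 1%Z]) t.
    by rewrite /= /Itv.num_sem/= realE !in_itv/= (ltW t0) (ltW t1).
  have /cA : x \in A by rewrite inE.
  move=> /(_ y); rewrite inE => /(_ Ay (Itv.mk t01) t0 t1).
  by rewrite inE.
apply/convex_setW => x y; rewrite !inE => Ax Ay k k0 k1; rewrite inE.
exact: cA.
Qed.

(** By induction on [s], each point is merged into [x]. The weight of [x] starts positive and only
    grows, so renormalising never divides by zero. *)
Lemma convex_combination A (I : Type) (s : seq I) (P : pred I) (c : I -> R)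
    (p : I -> 'cV[R]_d) (c0 : R) x :
  is_convex A -> 0 < c0 -> A x ->
  (forall i, P i -> 0 <= c i) -> (forall i, P i -> A (p i)) ->
  c0 + \sum_(i <- s | P i) c i = 1 ->
  A (c0 *: x + \sum_(i <- s | P i) c i *: p i).
Proof.
move=> /is_convexP cA + + c_ge0 Ap; elim: s c0 x => [|i s IHs] c0 x c0_gt0 Ax.
  by rewrite !big_nil !addr0 => ->; rewrite scale1r.
rewrite !big_cons; case: ifP => Pi; last exact: IHs.
have ci0 := c_ge0 _ Pi.
have := ci0; rewrite le_eqVlt => /predU1P[<-|ci_gt0].
  by rewrite scale0r !add0r; exact: IHs.
rewrite !addrA => sum1; have cs_gt0 : 0 < c0 + c i by rewrite addr_gt0.
have -> : c0 *: x + c i *: p i =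
    (c0 + c i) *: ((c0 / (c0 + c i)) *: x + (1 - c0 / (c0 + c i)) *: p i).
  rewrite scalerDr !scalerA; congr (_ *: _ + _ *: _); field; exact: lt0r_neq0.
apply: IHs => //; apply: cA => //; first exact: Ap.
  by rewrite divr_gt0.
by rewrite ltr_pdivrMr// mul1r ltrDl.
Qed.

(** With the points [p i] fixed, the combination is a homothety in [x] of nonzero ratio [c0] that
    maps [A] into itself, hence its interior into its interior. *)
Lemma convex_combination_interior A (I : Type) (s : seq I) (P : pred I)
    (c : I -> R) (p : I -> 'cV[R]_d) (c0 : R) x :
  is_convex A -> 0 < c0 -> interior A x ->
  (forall i, P i -> 0 <= c i) -> (forall i, P i -> A (p i)) ->
  c0 + \sum_(i <- s | P i) c i = 1 ->
  interior A (c0 *: x + \sum_(i <- s | P i) c i *: p i).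
Proof.
move=> cA c0_gt0 Ax c_ge0 Ap sum1.
apply: (@interior_homothety R 'cV[R]_d) => //; first exact: lt0r_neq0.
by move=> y Ay; exact: convex_combination.
Qed.

Lemma polyhedron_convex m (C : 'M[R]_(m, d)) (D : 'cV[R]_m) :
  is_convex (polyhedron C D).
Proof.
apply/is_convexP => x y t Px Py t0 t1 l.
rewrite mulmxDr -!scalemxAr !mxE.
have -> : D l 0 = t * D l 0 + (1 - t) * D l 0 by ring.
by apply: lerD; rewrite ler_pM2l ?subr_gt0//; [have := Px l | have := Py l];
  rewrite !mxE.
Qed.

End Convex.

(** * Fourier-Motzkin elimination and closedness of projections *)

Section FourierMotzkin.
Variable R : realType.

Lemma between_seqs (L U : seq R) :
  (forall l u, l \in L -> u \in U -> l <= u) ->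
  exists t, (forall l, l \in L -> l <= t) /\ (forall u, u \in U -> t <= u).
Proof.
elim: L => [_ | l L IHL LU].
  elim: U => [|u U [t [_ tU]]]; first by exists 0.
  exists (Num.min t u); split=> // v; rewrite inE => /predU1P[-> | /tU tv].
    by rewrite ge_min lexx orbT.
  by rewrite ge_min tv.
have [|t [Lt tU]] := IHL.
  by move=> l' u l'L; apply: LU; rewrite inE l'L orbT.
exists (Num.max t l); split=> [v | v vU].
  rewrite inE => /predU1P[-> | /Lt vt]; first by rewrite le_max lexx orbT.
  by rewrite le_max vt.
by rewrite ge_max tU// LU// mem_head.
Qed.

(* Multipliers of two constraints with leading coefficients [a] and [b]: those
   cancelling the leading variable if [b < 0 < a]; [(1, 0)] if [a = 0], which
   keeps the first constraint; otherwise [(0, 0)], giving the trivial [0 <= 0]. *)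
Definition fm_fst (a b : R) : R :=
  if a == 0 then 1 else if (0 < a) && (b < 0) then - b else 0.
Definition fm_snd (a b : R) : R :=
  if (0 < a) && (b < 0) then a else 0.

(** Negative coefficients bound [t] from below and positive ones from above; a common [t] exists
    once every lower bound is at most every upper bound. Indexing by all pairs keeps the new system
    over a finite type. *)
Lemma fourier_motzkin (I : finType) (a b : I -> R) :
  (exists t, forall i, a i * t <= b i) <->
  (forall i k, 0 <= fm_fst (a i) (a k) * b i + fm_snd (a i) (a k) * b k).
Proof.
split=> [[t ab] i k | ab].
  have [abi abk] := (ab i, ab k); rewrite /fm_fst /fm_snd.
  case: eqVneq abi => [-> | ai0] abi; first by rewrite ltxx/=; lra.
  case: ifPn => [/andP[ai_gt0 ak_lt0] | _]; last by lra.
  have h1 : 0 <= - a k * (b i - a i * t) by apply: mulr_ge0; lra.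
  have h2 : 0 <= a i * (b k - a k * t) by apply: mulr_ge0; lra.
  by lra.
pose L := [seq b i / a i | i <- enum I & a i < 0].
pose U := [seq b i / a i | i <- enum I & 0 < a i].
have [|t [Lt tU]] := @between_seqs L U.
  move=> _ _ /mapP[k + ->] /mapP[i + ->].
  rewrite !mem_filter => /andP[ak0 _] /andP[ai0 _].
  have := ab i k; rewrite /fm_fst /fm_snd ai0 ak0/= gt_eqF// => abik.
  rewrite ler_pdivlMr// mulrAC ler_ndivrMr//; lra.
exists t => i; case: (ltgtP (a i) 0) => [ai0 | ai0 | ai0].
- rewrite mulrC -ler_ndivrMr//; apply: Lt; apply/mapP; exists i => //.
  by rewrite mem_filter ai0 mem_enum.
- rewrite mulrC -ler_pdivlMr//; apply: tU; apply/mapP; exists i => //.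
  by rewrite mem_filter ai0 mem_enum.
(* When [a i = 0] the pair [(i, i)] says exactly [0 <= b i]. *)
- have := ab i i; rewrite /fm_fst /fm_snd ai0 eqxx ltxx/=; lra.
Qed.

(** Eliminating one coordinate of [x] yields a system of the same shape whose right-hand sides are
    linear combinations of the [g i], hence still continuous. With no coordinate left, the set is a
    finite intersection of closed sets [0 <= g i]. *)
Lemma closed_projection (T : topologicalType) (d : nat) (I : finType)
    (a : I -> 'I_d -> R) (g : I -> T -> R) :
  (forall i, continuous (g i)) ->
  closed [set y | exists x : 'I_d -> R,
                    forall i, \sum_q a i q * x q <= g i y].
Proof.
elim: d I a g => [|d IHd] I a g g_cont.
  rewrite [X in closed X](_ : _ =
      \bigcap_(i in [set: I]) (g i @^-1` [set z | 0 <= z])).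
    apply: closed_bigI => i _; apply: closed_comp; last exact: closed_ge.
    by move=> y _; exact: g_cont.
  apply/seteqP; split=> y /=.
    by move=> [x xg] i _; have := xg i; rewrite big_ord0.
  by move=> g0; exists (fun=> 0) => i; rewrite big_ord0; exact: g0.
pose u (c : I * I) := fm_fst (a c.1 ord0) (a c.2 ord0).
pose v (c : I * I) := fm_snd (a c.1 ord0) (a c.2 ord0).
pose a' c q := u c * a c.1 (lift ord0 q) + v c * a c.2 (lift ord0 q).
pose g' c y := u c * g c.1 y + v c * g c.2 y.
rewrite [X in closed X](_ : _ = [set y | exists x : 'I_d -> R,
    forall c, \sum_q a' c q * x q <= g' c y]).
  by apply: IHd => c y; apply: cvgD; apply: cvgM (cvg_cst _) _; exact: g_cont.
have fmE y (x : 'I_d -> R) :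
    (exists t, forall i,
       a i ord0 * t <= g i y - \sum_q a i (lift ord0 q) * x q) <->
    (forall c, \sum_q a' c q * x q <= g' c y).
  (* The slack of a combined constraint is the same combination of the two slacks. *)
  have sumE c : g' c y - \sum_q a' c q * x q =
      u c * (g c.1 y - \sum_q a c.1 (lift ord0 q) * x q) +
      v c * (g c.2 y - \sum_q a c.2 (lift ord0 q) * x q).
    rewrite !mulrBr !mulr_sumr addrACA -opprD -big_split/=; congr (_ - _).
    by apply: eq_bigr => q _; rewrite /a'; ring.
  rewrite fourier_motzkin; split=> [ag [i k] | ag i k].
    by rewrite -subr_ge0 sumE; exact: ag.
  by have := ag (i, k); rewrite -subr_ge0 sumE.
apply/seteqP; split=> y /= [x xg].
  exists (fun q => x (lift ord0 q)); apply/fmE; exists (x ord0) => i.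
  by rewrite lerBrDr; have := xg i; rewrite big_ord_recl.
have /fmE[t tg] := xg.
exists (fun q => oapp x t (unlift ord0 q)) => i.
rewrite big_ord_recl unlift_none/= -lerBrDr.
by under eq_bigr do rewrite liftK/=; exact: tg.
Qed.

End FourierMotzkin.

(** * Extreme points, bases and rays *)

Section BasicSolution.
Variables (R : realType) (m d : nat) (C : 'M[R]_(m, d)) (D : 'cV[R]_m).
Implicit Types (B : {set 'I_m}) (f g v : 'cV[R]_d).

(** If [v] leaves every active constraint unchanged, then for small [e] both [f + e *: v] and
    [f - e *: v] are feasible, with midpoint [f]; extremality forces [v = 0]. *)
Lemma extreme_point_active_inj f v : extreme_point (polyhedron C D) f ->
  (forall l, (C *m f) l 0 = D l 0 -> (C *m v) l 0 = 0) -> v = 0.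
Proof.
move=> [Pf extr] v_active.
pose c l := D l 0 - (C *m f) l 0.
have [e e_gt0 ec] : exists2 e : R, 0 < e &
    forall l, 0 < c l -> e * `|(C *m v) l 0| <= c l.
  have : forall l, exists e, 0 < e /\ (0 < c l -> e * `|(C *m v) l 0| <= c l).
    move=> l; have [cl0|cl0] := ltP 0 (c l); last by exists 1.
    (* The summand 1 avoids a zero denominator when [v] does not change constraint [l]. *)
    exists (c l / (1 + `|(C *m v) l 0|)).
    have h : 0 < 1 + `|(C *m v) l 0| by rewrite ltr_pwDl.
    split=> [|_]; first by rewrite divr_gt0.
    by rewrite -mulrA ler_piMr ?(ltW cl0)// mulrC ler_pdivrMr// mul1r lerDr.
  move=> /choice[e he]; exists (\big[Num.min/1]_l e l).
    by apply/bigmin_gtP; split=> // l _; case: (he l).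
  move=> l /(proj2 (he l)); apply: le_trans; apply: ler_wpM2r => //.
  exact: bigmin_le.
have Pe s : `|s| = e -> polyhedron C D (f + s *: v).
  move=> se l; rewrite mulmxDr -scalemxAr mxE [X in _ + X]mxE.
  rewrite addrC -lerBrDr -/(c l).
  have : 0 <= c l by rewrite subr_ge0.
  rewrite le_eqVlt => /predU1P[cl0|/ec]; last first.
    by apply: le_trans; rewrite -se -normrM ler_norm.
  rewrite -cl0 v_active ?mulr0//; apply/eqP.
  by rewrite eq_sym -subr_eq0 -/(c l) -cl0.
have [|||||/(congr1 (fun g => g - f)) + _] :=
  extr _ _ 2^-1 (Pe e _) (Pe (- e) _).
- by rewrite gtr0_norm.
- by rewrite normrN gtr0_norm.
- by rewrite invr_gt0.
- by rewrite invf_lt1// ltr1n.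
- rewrite (_ : 1 - 2^-1 = 2^-1 :> R); last by field.
  rewrite -scalerDr scaleNr addrACA subrr addr0.
  by rewrite -mulr2n -(scaler_nat 2 f) scalerA mulVf ?scale1r.
- rewrite addrAC !subrr add0r => /eqP; rewrite scaler_eq0 gt_eqF//=.
  by move/eqP.
Qed.

Definition basis_mx B : 'M[R]_(#|B|, d) :=
  rowsub (fun i : 'I_#|B| => enum_val i) C.

Lemma extreme_point_basic f : extreme_point (polyhedron C D) f ->
  exists B, basic_solution C D B f.
Proof.
move=> extr; pose act l := (C *m f) l 0 == D l 0.
(* Inactive rows are zeroed rather than removed, so that selected rows keep their index in [C]. *)
pose M := \matrix_l (if act l then row l C else 0).
have M_full : row_full M.
  rewrite /row_full -mxrank_tr; apply: inj_row_free => u uM.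
  apply: trmx_inj; rewrite trmx0.
  apply: (extreme_point_active_inj extr) => l /eqP al.
  have := congr1 (fun A : 'rV_m => A^T l 0) uM.
  rewrite trmx_mul trmxK trmx0 [RHS]mxE => <-; rewrite !mxE.
  by apply: eq_bigr => q _; rewrite !mxE /act al mxE.
pose b := fullrankfun M_full.
(* An inactive selected row would be zero, against the independence of the selection. *)
have rowb i : act (b i) /\ row i (rowsub b M) = row (b i) C.
  rewrite row_rowsub rowK; case: ifPn => // act_bi; exfalso.
  have := row_free_inj (fullrowsub_free M_full) (m := 1).
  move/(_ (delta_mx 0 i) 0).
  rewrite -rowE row_rowsub rowK (negPf act_bi) mul0mx.
  by move=> /(_ erefl)/matrixP/(_ 0 i)/eqP; rewrite !mxE !eqxx oner_eq0.
pose B : {set 'I_m} := finset.imset b (mem 'I_d).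
have cardB : #|B| = d by rewrite card_imset ?card_ord//; exact: fullrankfun_inj.
exists B; split=> //; last first.
  by move=> _ /imsetP[i _ ->]; apply/eqP; case: (rowb i).
(* [enum_val] may list [B] in another order than [b], so only row spaces are compared: each selected
   row of [M] is a row of [basis_mx B]. *)
rewrite /row_free eqn_leq rank_leq_row/= [leqLHS]cardB.
rewrite -[X in (X <= _)%N](mxrank_fullrowsub M_full).
apply/mxrankS/row_subP => i.
rewrite (proj2 (rowb i)) -/b.
have biB : b i \in B by apply/imsetP; exists i.
rewrite (_ : row _ _ = row (enum_rank_in biB (b i)) (basis_mx B)) ?row_sub//.
by rewrite row_rowsub enum_rankK_in.
Qed.

Lemma basis_mxE B v i : (basis_mx B *m v) i 0 = (C *m v) (enum_val i) 0.
Proof. by rewrite !mxE; apply: eq_bigr => q _; rewrite mxE. Qed.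

Lemma basic_solution_inj B f v : basic_solution C D B f ->
  (forall l, l \in B -> (C *m v) l 0 = 0) -> v = 0.
Proof.
move=> [cardB freeB _] Cv.
have B_full : row_full (basis_mx B) by rewrite /row_full (eqP freeB) cardB.
rewrite -[v]mul1mx -(mulVpmx B_full) -mulmxA.
suff -> : basis_mx B *m v = 0 by rewrite mulmx0.
apply/matrixP => i q; rewrite ord1 basis_mxE [RHS]mxE; apply: Cv.
exact: enum_valP.
Qed.

(** The rays are the columns of the inverse basis matrix, negated because a slack grows when its
    constraint value drops. *)
Lemma basic_solution_rays B f : basic_solution C D B f ->
  exists r, basic_rays C B r.
Proof.
move=> [_ freeB _].
pose e l : 'cV[R]_#|B| := \col_i - (enum_val i == l)%:R.
exists (fun l => pinvmx (basis_mx B) *m e l) => l q lB qB.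
rewrite -(enum_rankK_in lB qB) -basis_mxE mulmxA mulmxVp// mul1mx mxE.
by rewrite opprK.
Qed.

(** The basic slacks are the coordinates of [g] in the cone at [f]: both sides agree on every basic
    constraint, and these determine a vector. *)
Lemma basic_solution_expand B f r g :
  basic_solution C D B f -> basic_rays C B r ->
  g = f + \sum_(l in B) slack C D l g *: r l.
Proof.
move=> bs rays; apply/eqP; rewrite -subr_eq0; apply/eqP.
apply: (basic_solution_inj bs) => q qB; case: bs => _ _ fB.
rewrite mulmxBr mulmxDr mulmx_sumr mxE [X in _ + X]mxE [X in _ - X]mxE.
rewrite summxE fB//.
have termE l : l \in B ->
    (C *m (slack C D l g *: r l)) q 0 = - (slack C D l g * (q == l)%:R).
  by move=> lB; rewrite -scalemxAr mxE -(rays l q)// mulrN opprK.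
rewrite (bigD1 q)//= termE// big1 => [|l /andP[lB lq]].
  by rewrite eqxx mulr1 addr0 /slack; ring.
by rewrite termE// eq_sym (negPf lq) mulr0 oppr0.
Qed.

End BasicSolution.

(** * Validity and shape of the intersection cut *)

Section Cut.
Variables (R : realType) (m d : nat) (C : 'M[R]_(m, d)) (D : 'cV[R]_m).
Implicit Types (B : {set 'I_m}) (O : set 'cV[R]_d) (f g : 'cV[R]_d).

Lemma step_length_gt0 O f (v : 'cV[R]_d) :
  interior O f -> (0 < step_length O f v)%E.
Proof.
move=> /(@interior_ray R 'cV[R]_d _ _ v)[z z_gt0 Oz].
apply/ereal_sup_gtP; exists z%:E => //; exists z => //.
by split=> //; exact: ltW.
Qed.

(** The supremum may be infinite or not attained. With [c] the cut coefficient, [(c + e)^-1] is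
    strictly below the step length in either case, so some [z] beyond it still lands in [O]. *)
Lemma step_length_approx O f (v : 'cV[R]_d) (e : R) :
  interior O f -> 0 < e ->
  exists z : R, [/\ 0 < z, O (f + z *: v)
                  & z^-1 <= fine (step_length O f v)^-1%E + e].
Proof.
move=> Of e_gt0; set s := step_length O f v; pose c := fine s^-1%E.
have s_gt0 : (0 < s)%E by exact: step_length_gt0.
have [c_ge0 ces] : 0 <= c /\ (((c + e)^-1)%:E < s)%E.
  rewrite {}/c; case: s s_gt0 => [s| |]//=; rewrite ?lte_fin => s_gt0.
    rewrite fine_invr invr_ge0 ltW//; split=> //.
    by rewrite ?lte_fin invf_plt ?posrE ?addr_gt0 ?invr_gt0// ltrDl.
  by rewrite ltry.
have ce_gt0 : 0 < c + e by rewrite ltr_wpDl.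
have /ereal_sup_gtP[_ [z [z_ge0 Oz] <-]] := ces; rewrite lte_fin => ltz.
have z_gt0 : 0 < z by apply: lt_trans ltz; rewrite invr_gt0.
by exists z; split=> //; rewrite invf_ple ?posrE// ltW.
Qed.

(* A point [g] violating the cut lies in the interior of [O]: it is a convex
   combination of [f], with positive weight, and of points [f + z_l r_l] of [O]
   with [z_l] close enough to the step length. *)
Lemma intersection_cut_valid B O f g r :
  is_convex O -> interior O f ->
  basic_solution C D B f -> basic_rays C B r ->
  polyhedron C D g -> ~ interior O g -> cut_halfspace C D B r O f g.
Proof.
move=> cO Of bs rays Pg; apply: contra_notP; rewrite /cut_halfspace/=.
move/negP; rewrite -ltNge => cut_lt1.
set sl := fun l => slack C D l g.
have sl_ge0 l : 0 <= sl l by rewrite subr_ge0; exact: Pg.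
pose c l := fine (step_length O f (r l))^-1%E.
rewrite -/(c _) in cut_lt1.
pose cut := \sum_(l in B) c l * sl l; have {}cut_lt1 : cut < 1 by [].
pose tot := \sum_(l in B) sl l.
have tot_ge0 : 0 <= tot by apply: sumr_ge0.
(* This choice gives [e * tot < 1 - cut], even if [tot = 0], so replacing step lengths by [z] keeps
   the total weight below 1. *)
pose e := (1 - cut) / (1 + tot).
have e_gt0 : 0 < e by rewrite divr_gt0 ?subr_gt0// ltr_pwDl.
have /choice[z zP] := fun l => step_length_approx (r l) Of e_gt0.
pose c0 := 1 - \sum_(l in B) sl l / z l.
have c0_gt0 : 0 < c0.
  rewrite subr_gt0; apply: (@le_lt_trans _ _ (cut + e * tot)).
    rewrite mulr_sumr -big_split/=; apply: ler_sum => l lB.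
    have [_ _ zc] := zP l.
    by rewrite -mulrDl mulrC ler_wpM2r.
  rewrite addrC -ltrBrDr /e mulrAC ltr_pdivrMr; last by rewrite ltr_pwDl.
  by rewrite ltr_pM2l ?subr_gt0// ltrDr.
have -> : g = c0 *: f + \sum_(l in B) (sl l / z l) *: (f + z l *: r l).
  rewrite [LHS](basic_solution_expand g bs rays).
  under [in RHS]eq_bigr => l lB.
    rewrite scalerDr scalerA divfK; last by have [/lt0r_neq0] := zP l.
    over.
  by rewrite big_split/= -scaler_suml addrA -scalerDl subrK scale1r.
apply: convex_combination_interior => //.
- by move=> l _; have [z_gt0 _ _] := zP l; rewrite divr_ge0// ltW.
- by move=> l _; have [] := zP l.
- by rewrite subrK.
Qed.

(** Substituting the slacks turns the cut into one linear inequality [w *m g <= b], appended as a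
    last row. *)
Lemma cut_halfspace_polyhedron B O f r :
  is_polyhedron (polyhedron C D `&` cut_halfspace C D B r O f).
Proof.
pose c l := fine (step_length O f (r l))^-1%E.
pose w : 'rV[R]_d := \sum_(l in B) c l *: row l C.
pose b : 'cV[R]_1 := const_mx (\sum_(l in B) c l * D l 0 - 1).
exists (m + 1)%N, (col_mx C w), (col_mx D b).
have wE g : (w *m g) 0 0 = \sum_(l in B) c l * (C *m g) l 0.
  rewrite mulmx_suml summxE; apply: eq_bigr => l _.
  by rewrite -scalemxAl mxE -row_mul mxE.
have cutE g : cut_halfspace C D B r O f g <-> (w *m g) 0 0 <= b 0 0.
  rewrite /cut_halfspace/= wE mxE lerBrDr addrC -lerBrDr -sumrB.
  rewrite (eq_bigr (fun l => c l * D l 0 - c l * (C *m g) l 0))// => l _.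
  by rewrite -mulrBr.
apply/seteqP; split=> g /=.
  move=> [Pg /cutE cg] l; rewrite mul_col_mx -(splitK l).
  case: (fintype.split l) => i /=; first by rewrite !col_mxEu; exact: Pg.
  by rewrite !col_mxEd [i]ord1.
move=> P; split=> [l|].
  by have := P (lshift 1 l); rewrite mul_col_mx !col_mxEu.
by apply/cutE; have := P (rshift m 0); rewrite mul_col_mx !col_mxEd.
Qed.

Lemma cut_halfspace_violated B O f r :
  basic_solution C D B f -> ~ cut_halfspace C D B r O f f.
Proof.
move=> [_ _ fB]; rewrite /cut_halfspace/= big1 ?ler10// => l lB.
by rewrite /slack fB// subrr mulr0.
Qed.

End Cut.

(** * Closedness and convexity of the sets of the game *)

Lemma dsubmx_continuous (R : realType) (m1 m2 p : nat) :
  continuous (@dsubmx R m1 m2 p).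
Proof.
move=> f A /nbhs_ballP[e /= e_gt0 eA].
apply/nbhs_ballP; exists e => //= g [_ fg].
by apply: eA; split=> // i q; rewrite !mxE; exact: fg.
Qed.

Section GameSets.
Variables (R : realType) (n k j : nat) (G : lp_game n k j) (S : {set 'I_n}).
Implicit Types (u : 'cV[R]_n).

(* [Z(S)] as the system [\sum_q Uset_coef c q * x q <= Uset_bound c u]; the
   constraints indexed by players outside [S] are the trivial [0 <= 0]. *)
Definition Uset_coef (c : 'I_j + 'I_k + 'I_n) (q : 'I_j) : R :=
  match c with
  | inl (inl q') => - (q' == q)%:R
  | inl (inr p) => ratr (production G p q)
  | inr i => if i \in S then - ratr (valuation G i q 0) else 0
  end.

Definition Uset_bound (c : 'I_j + 'I_k + 'I_n) u : R :=
  match c with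
  | inl (inl _) => 0
  | inl (inr p) => ratr ((\sum_(i in S) endowment G i) p 0)
  | inr i => if i \in S then - u i 0 else 0
  end.

(** Separating the eliminated [x] from the parameter [u] gives the form required by
    [closed_projection]. *)
Lemma UsetE : Uset R G S =
  [set u | exists x : 'I_j -> R,
    forall c, \sum_q Uset_coef c q * x q <= Uset_bound c u].
Proof.
have valE (x : 'cV[R]_j) i : i \in S ->
    ((map_mx ratr (valuation G i))^T *m x) 0 0 =
    - \sum_q Uset_coef (inr i) q * x q 0.
  move=> iS; rewrite mxE -sumrN; apply: eq_bigr => q _.
  by rewrite /= iS mulNr opprK !mxE.
have prodE (x : 'cV[R]_j) p : (map_mx ratr (production G) *m x) p 0 =
    \sum_q Uset_coef (inl (inr p)) q * x q 0.
  by rewrite mxE; apply: eq_bigr => q _; rewrite mxE.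
have posE (x : 'I_j -> R) q : \sum_q' Uset_coef (inl (inl q)) q' * x q' = - x q.
  rewrite (bigD1 q)//= big1 => [|q' q'q]; first by rewrite eqxx mulN1r addr0.
  by rewrite eq_sym (negPf q'q) oppr0 mul0r.
apply/seteqP; split=> [_ [f [[f_ge0 fA] fv] <-] | u /= [x xc]].
  exists (fun q => usubmx f q 0) => -[[q|p]|i].
  - by rewrite (posE (fun q => usubmx f q 0)) oppr_le0; exact: f_ge0.
  - by rewrite -prodE; exact: fA.
  - case: (boolP (i \in S)) => iS.
      have := fv _ iS; rewrite valE// lerNr => h.
      by rewrite /Uset_bound iS.
    rewrite /Uset_bound (negPf iS) big1// => q _.
    by rewrite /= (negPf iS) mul0r.
exists (col_mx (\col_q x q) u); last by rewrite col_mxKd.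
have colE c : \sum_q Uset_coef c q * (\col_q x q : 'cV[R]_j) q 0 =
    \sum_q Uset_coef c q * x q by apply: eq_bigr => q _; rewrite mxE.
split=> [|i iS]; rewrite col_mxKu.
  split=> [q|p]; first by have := xc (inl (inl q)); rewrite posE oppr_le0 mxE.
  by rewrite prodE colE; exact: xc.
rewrite col_mxKd valE// colE lerNr.
by have := xc (inr i); rewrite /Uset_bound iS.
Qed.

Lemma Uset_closed : closed (Uset R G S).
Proof.
rewrite UsetE; apply: closed_projection => -[[q|p]|i] u /=.
- exact: (@cst_continuous _ R).
- exact: (@cst_continuous _ R).
rewrite /Uset_bound; case: (i \in S); last exact: (@cst_continuous _ R).
by apply: (@continuousN _ R) => /=; exact: (@coord_continuous R n 1 i 0).
Qed.

Lemma Uset_convex : is_convex (Uset R G S).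
Proof.
apply/is_convexP => u v t; rewrite UsetE => -[x xu] [y yv] t0 t1.
exists (fun q => t * x q + (1 - t) * y q) => c.
have -> : Uset_bound c (t *: u + (1 - t) *: v) =
    t * Uset_bound c u + (1 - t) * Uset_bound c v.
  case: c {xu yv} => [[q|p]|i] /=; [by ring|by ring|].
  by case: ifP => _; rewrite ?mxE; ring.
rewrite (eq_bigr (fun q => t * (Uset_coef c q * x q) +
    (1 - t) * (Uset_coef c q * y q))) => [|q _]; last by ring.
rewrite big_split/= -!mulr_sumr.
by apply: lerD; rewrite ler_pM2l ?subr_gt0.
Qed.

Lemma U'set_closed : closed (U'set R G S).
Proof.
apply: (proj1 (continuous_closedP _) (@dsubmx_continuous R j n 1)).
exact: Uset_closed.
Qed.

Lemma U'set_convex : is_convex (U'set R G S).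
Proof.
apply/is_convexP => f g t Uf Ug t0 t1; rewrite /U'set /= linearD !linearZ/=.
by move/is_convexP : Uset_convex; apply.
Qed.

Lemma interior_U'set (f : 'cV[R]_(j + n)) :
  interior (Uset R G S) (dsubmx f) -> interior (U'set R G S) f.
Proof. exact: dsubmx_continuous. Qed.

End GameSets.

Theorem theorem3p18 (R : realType) (n k j : nat)
    (n_gt0 : (0 < n)%N) (k_gt0 : (0 < k)%N) (j_gt0 : (0 < j)%N)
    (G : lp_game n k j)
    (m : nat) (C : 'M[R]_(m, j + n)) (D : 'cV[R]_m)
    (P' := polyhedron C D)
    (convP' : convex_hull (extended_core R G) `<=` P')
    (P'Z : P' `<=` Zset R G finset.setT)
    (xstar : 'cV[R]_j) (ustar : 'cV[R]_n)
    (extr : extreme_point P' (col_mx xstar ustar))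
    (ustar_core : ~ core R G ustar) :
  exists (S : {set 'I_n}) (H : set 'cV[R]_(j + n)),
    [/\ coalition S,
        intersection_cut C D (U'set R G S) (col_mx xstar ustar) H
      & let Phat := P' `&` H in
        [/\ is_polyhedron Phat,
            convex_hull (extended_core R G) `<=` Phat,
            Phat `<` P'
          & P' `<=` Zset R G finset.setT]].
Proof.
have Pstar : P' (col_mx xstar ustar) := proj1 extr.
have [S S_coal Sstar] :
    (\bigcup_(S in @coalition n) interior (Uset R G S)) ustar.
  apply: contra_notP ustar_core => not_blocked; split=> //.
  by exists (col_mx xstar ustar); [exact: P'Z | rewrite col_mxKd].
have int_star : interior (U'set R G S) (col_mx xstar ustar).
  by apply: interior_U'set; rewrite col_mxKd.
have [B bs] := extreme_point_basic extr.
have [r rays] := basic_solution_rays bs.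
pose H := cut_halfspace C D B r (U'set R G S) (col_mx xstar ustar).
have Phat_poly : is_polyhedron (P' `&` H) by exact: cut_halfspace_polyhedron.
exists S, H; split=> //.
  split=> //; [exact: U'set_closed | exact: U'set_convex |].
  by exists B, r.
split=> //.
- apply: smallest_sub.
    (* The hull is the smallest convex superset, so it is enough that the polyhedron is convex and
       contains the extended core. *)
    by have [m' [C' [D' ->]]] := Phat_poly; exact: polyhedron_convex.
  move=> f fcore; split; first by apply: convP'; exact: sub_gen_smallest.
  have [_ f_blocked] := fcore.
  apply: intersection_cut_valid => //; first exact: U'set_convex.
    by apply: convP'; exact: sub_gen_smallest.
  by move=> Uf; apply: f_blocked; exists S.
(* Strictness is witnessed by the extreme point, where all basic slacks vanish. *)
- split=> [f [] //|PPhat].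
  exact: (cut_halfspace_violated bs (proj2 (PPhat _ Pstar))).
Qed.
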